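(* Let $n\ge 2$ be an integer, let $p\in\mathbb{R}$, $p\ne -n$, and let $k\in\mathbb{N}\cup\{0\}$. Then $$\binom{n\frac{n-p}{n+p}}{k}=\sum_{m=0}^{k}\binom{\frac{n(1-p)}{n+p}}{k-m}\sum_{\substack{i_1,\dots,i_{n-1}\ge 0\\ i_1+2i_2+\dots+(n-1)i_{n-1}=m}}c(n,p,i(m))\prod_{j=1}^{n-1}\binom{n-1}{j}^{i_j}.$$
   Context: For $\alpha\in\mathbb{R}$ and integers $k\ge 0$ the generalized binomial coefficient is $\binom{\alpha}{0}=1$ and $\binom{\alpha}{k}=\frac{\alpha(\alpha-1)\cdots(\alpha-k+1)}{k!}$ for $k>0$. The inner sum runs over tuples of non-negative integers $(i_1,\dots,i_{n-1})$, and for such a tuple with $i_1+2i_2+\dots+(n-1)i_{n-1}=m$, $$c(n,p,i(m))=\binom{\frac{n}{n+p}}{i_1+\dots+i_{n-1}}\frac{(i_1+\dots+i_{n-1})!}{i_1!\,i_2!\cdots i_{n-1}!}.$$ *)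

(* Defs.v *)
From HB Require Import structures.
From mathcomp Require Import all_boot all_order all_algebra.
From mathcomp Require Import reals.

Set Implicit Arguments.
Unset Strict Implicit.
Unset Printing Implicit Defensive.

Import Order.TTheory GRing.Theory Num.Theory.
Local Open Scope ring_scope.

(* The product is empty for k = 0, so gbinom a 0 = 1. *)
Definition gbinom (R : realType) (a : R) (k : nat) : R :=
  (\prod_(l < k) (a - l%:R)) / k`!%:R.

(* A tuple (i_1, ..., i_(n-1)) is a function i on 'I_n.-1: the ordinals count
   from 0, so i_(j+1) in the usual numbering is i j. *)
Definition isum (n : nat) (i : 'I_n.-1 -> nat) : nat :=
  (\sum_(j < n.-1) i j)%N.

Definition iweight (n : nat) (i : 'I_n.-1 -> nat) : nat :=
  (\sum_(j < n.-1) j.+1 * i j)%N.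

Definition ccoef (R : realType) (n : nat) (p : R) (i : 'I_n.-1 -> nat) : R :=
  gbinom (n%:R / (n%:R + p)) (isum i) *
  ((isum i)`!%:R / \prod_(j < n.-1) (i j)`!%:R).

(* All entries of a tuple of weight m are at most m, so that the tuples of
   weight m may be taken in the finite type {ffun 'I_n.-1 -> 'I_m.+1}. *)
Lemma iweight_bound (n m : nat) (i : 'I_n.-1 -> nat) :
  iweight i = m -> forall j, (i j < m.+1)%N.
Proof.
move=> <- j; rewrite ltnS /iweight (bigD1 j) //=.
by rewrite (leq_trans _ (leq_addr _ _)) // leq_pmull.
Qed.

(* Main.v *)
Require Import Defs.
From HB Require Import structures.
From mathcomp Require Import all_boot all_order all_algebra.
From mathcomp Require Import reals.
From mathcomp Require Import ring.

Set Implicit Arguments.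
Unset Strict Implicit.
Unset Printing Implicit Defensive.

Import Order.TTheory GRing.Theory Num.Theory.
Local Open Scope ring_scope.

(** With [a = n / (n + p)], the inner sum is the coefficient of [x ^ m] in
    [(1 + y) ^ a], where [y = \sum_(j < n.-1) 'C(n.-1, j.+1) x ^ j.+1]: expand
    by the binomial series in [y], and each [y ^ s] by the multinomial theorem.
    Since [1 + y = (1 + x) ^ n.-1], that coefficient is [gbinom ((n - 1) a) m],
    and the theorem is the Chu-Vandermonde convolution for the exponents
    [n (1 - p) / (n + p)] and [(n - 1) a], whose sum is [n (n - p) / (n + p)].

    Power series can be avoided: for a fixed degree, the value of the inner sum
    ([inner_sumE]) and the convolution ([gbinom_Vandermonde]) are polynomial
    identities in the exponents, so it suffices to check them at natural
    numbers ([polyfun_eq]). There the first is a comparison of coefficients in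
    [(1 + 'X) ^+ (r * N)] ([inner_sum_nat]) and the second is the Vandermonde
    identity for natural binomial coefficients. *)

(** * Polynomial functions of the exponent *)

Definition polyfun (R : realType) (f : R -> R) : Prop :=
  exists q : {poly R}, forall x, f x = q.[x].

Lemma polyfun_cst (R : realType) (c : R) : polyfun (fun=> c).
Proof. by exists c%:P => x; rewrite hornerC. Qed.

Lemma polyfun_mul (R : realType) (f g : R -> R) :
  polyfun f -> polyfun g -> polyfun (fun x => f x * g x).
Proof. by move=> [q Hq] [r Hr]; exists (q * r) => x; rewrite hornerM Hq Hr. Qed.

Lemma polyfun_sum (R : realType) (I : finType) (P : pred I)
    (f : I -> R -> R) :
  (forall i, polyfun (f i)) -> polyfun (fun x => \sum_(i | P i) f i x).
Proof.
move=> Hf; elim: (index_enum I) => [|i s [q Hq]].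
  by exists 0 => x; rewrite big_nil horner0.
have [q' Hq'] := Hf i; exists ((if P i then q' else 0) + q) => x.
by rewrite big_cons hornerD -Hq; case: ifP => _; rewrite ?Hq' ?horner0 ?add0r.
Qed.

Lemma polyfun_gbinom (R : realType) (b c : R) k :
  polyfun (fun x => gbinom (b * x + c) k).
Proof.
exists ((\prod_(l < k) (b *: 'X + (c - l%:R)%:P)) * (k`!%:R^-1)%:P) => x.
rewrite hornerM hornerC horner_prod /gbinom; congr (_ * _).
by apply: eq_bigr => l _; rewrite hornerD hornerZ hornerX hornerC addrA.
Qed.

(** The difference of the two polynomials has infinitely many roots. *)
Lemma polyfun_eq (R : realType) (f g : R -> R) :
  polyfun f -> polyfun g -> (forall N : nat, f N%:R = g N%:R) ->
  forall x, f x = g x.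
Proof.
move=> [q Hq] [r Hr] Hfg x; rewrite Hq Hr; congr (_.[x]); apply/eqP.
rewrite -subr_eq0; apply/eqP.
apply: (@roots_geq_poly_eq0 _ _ [seq i%:R | i <- iota 0 (size (q - r))]).
- apply/allP => _ /mapP[N _ ->].
  by rewrite /root hornerD hornerN -Hq -Hr Hfg subrr.
- by rewrite map_inj_uniq ?iota_uniq //; apply: mulrIn; rewrite oner_eq0.
- by rewrite size_map size_iota.
Qed.

(** * Generalized binomial coefficients *)

Lemma gbinom_nat (R : realType) (N k : nat) :
  gbinom (N%:R : R) k = 'C(N, k)%:R.
Proof.
rewrite /gbinom; apply: (canLR (mulfK _)).
  by rewrite pnatr_eq0 -lt0n fact_gt0.
rewrite -natrM bin_ffact ffact_prod natr_prod.
have [lekN|ltNk] := leqP k N.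
  by apply: eq_bigr => l _; rewrite natrB // ltnW // (leq_trans (ltn_ord l)).
(* For k > N both products contain a zero factor, the one of index N. *)
rewrite (bigD1 (Ordinal ltNk)) //= subrr mul0r.
by rewrite (bigD1 (Ordinal ltNk)) //= subnn mul0r.
Qed.

(** Both sides are polynomial in [a] and in [b], and for natural exponents this
    is the usual Vandermonde identity. *)
Lemma gbinom_Vandermonde (R : realType) (a b : R) k :
  gbinom (a + b) k = \sum_(m < k.+1) gbinom a (k - m)%N * gbinom b m.
Proof.
have polyl c : polyfun (fun x : R => gbinom (x + c) k).
  by have [q Hq] := polyfun_gbinom 1 c k; exists q => x; rewrite -Hq mul1r.
have polyg j : polyfun (fun x : R => gbinom x j).
  by have [q Hq] := polyfun_gbinom (1 : R) 0 j; exists q => x;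
     rewrite -Hq mul1r addr0.
(* Fix b and reduce to natural a, then fix that a and reduce to natural b. *)
pose rhs x y : R := \sum_(m < k.+1) gbinom x (k - m)%N * gbinom y m.
apply: (polyfun_eq (f := fun x => gbinom (x + b) k) (g := fun x => rhs x b)).
- exact: polyl.
- by apply: polyfun_sum => m; apply: polyfun_mul (polyfun_cst _).
move=> M; rewrite addrC.
apply: (polyfun_eq (f := fun y => gbinom (y + M%:R) k) (g := rhs M%:R)).
- exact: polyl.
- by apply: polyfun_sum => m; apply: polyfun_mul => //; apply: polyfun_cst.
move=> N; rewrite -natrD gbinom_nat -binomial.Vandermonde natr_sum.
by apply: eq_bigr => m _; rewrite natrM mulrC !gbinom_nat.
Qed.

(** * The multinomial theorem *)

(** A truncation of the series [exp (c T)], where the formal variable [T] keeps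
    track of the exponent of [c]. *)
Definition texp (F : numFieldType) (A : comAlgType F) (m : nat) (c : A) :
  {poly A} := \poly_(t < m.+1) ((t`!%:R : F)^-1 *: c ^+ t).

(** The exponential of a sum is the product of the exponentials. *)
Lemma coef_prod_texp (F : numFieldType) (A : comAlgType F) (I : Type)
    (r : seq I) (c : I -> A) (m s : nat) : (s <= m)%N ->
  (\prod_(j <- r) texp m (c j))`_s =
  (s`!%:R : F)^-1 *: (\sum_(j <- r) c j) ^+ s.
Proof.
have fact_neq0 t : (t`!%:R : F) != 0 by rewrite pnatr_eq0 -lt0n fact_gt0.
elim: r s => [|j r IHr] s les.
  rewrite !big_nil coef1 expr0n; case: s les => [|s] _ //=.
    by rewrite invr1 scale1r.
  by rewrite scaler0.
rewrite !big_cons coefMr exprDn scaler_sumr; apply: eq_bigr => t _.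
have lets : (t <= s)%N by rewrite -ltnS.
rewrite IHr ?(leq_trans lets) // coef_poly ltnS (leq_trans (leq_subr _ _)) //.
rewrite -scalerAr -scalerAl scalerA -scaler_nat scalerA; congr (_ *: _).
rewrite -(bin_fact lets) !natrM !invfM mulrAC mulVf ?mul1r //.
by rewrite pnatr_eq0 -lt0n bin_gt0.
Qed.

(** Both sides are [s`!] times the coefficient of degree [s] in the product of
    the truncated exponential series of the [c j]; the right-hand side comes
    from expanding that product. As [s <= m], the truncation is harmless. *)
Lemma multinomial (F : numFieldType) (A : comAlgType F) (r : nat)
    (c : 'I_r -> A) (m s : nat) : (s <= m)%N ->
  (\sum_j c j) ^+ s =
  \sum_(i : {ffun 'I_r -> 'I_m.+1} | (\sum_j i j)%N == s)
    ((s`!%:R / \prod_j (i j)`!%:R) : F) *: \prod_j c j ^+ i j.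
Proof.
move=> les; have fact_neq0 : (s`!%:R : F) != 0.
  by rewrite pnatr_eq0 -lt0n fact_gt0.
apply: (can_inj (scalerKV fact_neq0)); rewrite /= -(coef_prod_texp _ _ les).
rewrite (eq_bigr _ (fun j _ => poly_def _ _)) bigA_distr_bigA coef_sum /=.
rewrite scaler_sumr [RHS]big_mkcond /=; apply: eq_bigr => i _.
rewrite (eq_bigr _ (fun j _ => esym (mul_polyC _ _))) big_split /= -rmorph_prod.
rewrite mul_polyC coefZ prodrXr coefXn eq_sym; case: eqP => _.
  by rewrite mulr1 scaler_prod scalerA prodfV mulrA mulVf ?mul1r.
by rewrite mulr0.
Qed.
(** * The inner sum as a coefficient of a power of a binomial *)

(** The inner sum of the theorem, for [r = n.-1] and an arbitrary exponent. *)
Definition inner_sum (R : realType) (r m : nat) (a : R) : R :=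
  \sum_(i : {ffun 'I_r -> 'I_m.+1} | (\sum_(j < r) j.+1 * i j)%N == m)
    gbinom a (\sum_(j < r) i j)%N *
    ((\sum_(j < r) i j)%N`!%:R / \prod_(j < r) (i j)`!%:R) *
    \prod_(j < r) 'C(r, j.+1)%:R ^+ i j.

Definition binom_tail (R : realType) (r : nat) : {poly R} :=
  \sum_(j < r) 'C(r, j.+1)%:R *: 'X^(j.+1).

Lemma binom_tailE (R : realType) (r : nat) :
  (1 + 'X) ^+ r = 1 + binom_tail R r.
Proof.
rewrite exprDn big_ord_recl /= subn0 expr1n bin0 mulr1; congr (_ + _).
by apply: eq_bigr => j _; rewrite expr1n mul1r scaler_nat.
Qed.

Lemma coef_exp1DX (R : realType) (N m : nat) :
  ((1 + 'X : {poly R}) ^+ N)`_m = 'C(N, m)%:R.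
Proof.
rewrite exprDn coef_sum; have [lemN|ltNm] := leqP m N.
  rewrite (bigD1 (Ordinal (lemN : (m < N.+1)%N))) //= big1 => [|i nei].
    by rewrite expr1n mul1r coefMn coefXn eqxx addr0.
  rewrite -val_eqE /= eq_sym in nei.
  by rewrite expr1n mul1r coefMn coefXn (negPf nei) mul0rn.
rewrite big1 ?bin_small // => i _; rewrite expr1n mul1r coefMn coefXn.
by rewrite gtn_eqF ?mul0rn // (leq_trans _ ltNm).
Qed.

Lemma coef_binom_tail_small (R : realType) (r s m : nat) : (m < s)%N ->
  (binom_tail R r ^+ s)`_m = 0.
Proof.
move=> ltms; suff ->: binom_tail R r =
  (\sum_(j < r) 'C(r, j.+1)%:R *: 'X^j) * 'X by rewrite exprMn coefMXn ltms.
by rewrite mulr_suml; apply: eq_bigr => j _; rewrite -scalerAl exprSr.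
Qed.

(** By the multinomial theorem: the term of index [i] is a monomial whose degree
    is the weight of [i]. *)
Lemma coef_binom_tail (R : realType) (r s m : nat) : (s <= m)%N ->
  (binom_tail R r ^+ s)`_m =
  \sum_(i : {ffun 'I_r -> 'I_m.+1} | (\sum_(j < r) i j)%N == s)
    (s`!%:R / \prod_(j < r) (i j)`!%:R) * \prod_(j < r) 'C(r, j.+1)%:R ^+ i j *
    ((\sum_(j < r) j.+1 * i j)%N == m)%:R.
Proof.
move=> les; rewrite (@multinomial R {poly R} _ _ m s les) coef_sum.
apply: eq_bigr => i _; rewrite coefZ -mulrA; congr (_ * _).
under eq_bigr => j _ do rewrite exprZn -exprM.
by rewrite scaler_prod coefZ prodrXr coefXn eq_sym.
Qed.

(** Every tuple of weight [m] has sum at most [m], so the powers [s <= m] of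
    the tail account for all of them, and the higher powers do not contribute
    to the coefficient of [x ^ m]. *)
Lemma inner_sum_nat (R : realType) (r m N : nat) :
  inner_sum r m (N%:R : R) = 'C(r * N, m)%:R.
Proof.
transitivity
  (\sum_(s < m.+1) 'C(N, s)%:R * (binom_tail R r ^+ s)`_m); last first.
  rewrite -coef_exp1DX exprM binom_tailE exprDn coef_sum.
  pose G s := 'C(N, s)%:R * (binom_tail R r ^+ s)`_m.
  under [RHS]eq_bigr => s _ do rewrite expr1n mul1r coefMn -mulr_natl.
  (* Both sides are the sum of [G] over all s: [G s] vanishes for s > N
     and for s > m. *)
  rewrite -[LHS]/(\sum_(s < m.+1) G s) -[RHS]/(\sum_(s < N.+1) G s).
  have extend M : (forall s, (M < s)%N -> G s = 0) ->
      forall L, (M <= L)%N -> \sum_(s < M.+1) G s = \sum_(s < L.+1) G s.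
    move=> G0 L leML; rewrite (big_ord_widen L.+1 G) // [LHS]big_mkcond /=.
    by apply: eq_bigr => s _; case: ltnP => // /G0.
  rewrite (extend m _ (m + N)%N) ?leq_addr // => [|s ltms]; last first.
    by rewrite /G coef_binom_tail_small ?mulr0.
  rewrite [RHS](extend N _ (m + N)%N) ?leq_addl // => s ltNs.
  by rewrite /G bin_small ?mul0r.
under [RHS]eq_bigr => s _ do
  rewrite coef_binom_tail -1?ltnS // mulr_sumr.
rewrite (exchange_big_dep predT) //= /inner_sum big_mkcond /=.
apply: eq_bigr => i _; case: eqP => [wi|_]; last first.
  by rewrite big1 // => s _; rewrite !mulr0.
have sum_le : (\sum_(j < r) i j < m.+1)%N.
  by rewrite ltnS -[X in (_ <= X)%N]wi leq_sum // => j _; rewrite leq_pmull.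
rewrite (big_pred1 (Ordinal sum_le)) /= => [|s]; last by rewrite eq_sym.
by rewrite gbinom_nat mulr1 -[LHS]mulrA.
Qed.

(** Both sides are polynomial in [a], so the natural exponents decide. *)
Lemma inner_sumE (R : realType) (r m : nat) (a : R) :
  inner_sum r m a = gbinom (r%:R * a) m.
Proof.
apply: (polyfun_eq (f := inner_sum r m) (g := fun x => gbinom (r%:R * x) m)).
- apply: polyfun_sum => i; apply: polyfun_mul (polyfun_cst _).
  apply: polyfun_mul (polyfun_cst _).
  have [q Hq] := polyfun_gbinom (1 : R) 0 (\sum_(j < r) i j)%N.
  by exists q => x; rewrite -Hq mul1r addr0.
- have [q Hq] := polyfun_gbinom (r%:R : R) 0 m.
  by exists q => x; rewrite -Hq addr0.
- by move=> N; rewrite inner_sum_nat -natrM gbinom_nat.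
Qed.

(** * The identity *)

Theorem mainTheorem4 (R : realType) (n : nat) (p : R) (k : nat)
  (hn : (2 <= n)%N) (hp : p <> - n%:R) :
  gbinom (n%:R * ((n%:R - p) / (n%:R + p))) k =
  \sum_(m < k.+1)
    gbinom (n%:R * (1 - p) / (n%:R + p)) (k - m)%N *
    \sum_(i : {ffun 'I_n.-1 -> 'I_m.+1} | iweight (fun j => i j) == m)
      ccoef p (fun j => i j) *
      \prod_(j < n.-1) 'C(n.-1, j.+1)%:R ^+ i j.
Proof.
have np_neq0 : n%:R + p != 0 by rewrite addrC addr_eq0; apply/eqP.
have -> : n%:R * ((n%:R - p) / (n%:R + p)) =
    n%:R * (1 - p) / (n%:R + p) + n.-1%:R * (n%:R / (n%:R + p)).
  case: n hn {hp} np_neq0 => // n _ /=.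
  by rewrite -natr1 => np_neq0; field.
rewrite gbinom_Vandermonde; apply: eq_bigr => m _.
by rewrite -inner_sumE.
Qed.
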